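(* For every integer $n\ge 9$, $$\max\{f(P(n),M): M\in\mathcal{M}_1(P(n))\}=\left\lceil \frac{n}{4}\right\rceil .$$
   Context: For $n\ge 3$, $P(n)=P(n,2)$ is the simple graph with vertex set $\{u_i,v_i:0\le i\le n-1\}$ and edge set $\{u_iu_{i+2},\,u_iv_i,\,v_iv_{i+1}:0\le i\le n-1\}$, subscripts modulo $n$. The edges $u_iv_i$ are called spokes. For a perfect matching $M$ of a graph $G$, a forcing set of $M$ is a subset $S\subseteq M$ contained in no perfect matching of $G$ other than $M$; the forcing number $f(G,M)$ is the minimum cardinality of a forcing set of $M$. $\mathcal{M}_1(P(n))$ is the set of perfect matchings $M$ of $P(n)$ such that either (i) $M$ contains at least one spoke, and for any two (cyclically) consecutive spokes $u_iv_i,u_jv_j$ of $M$ the number of spokes $u_kv_k$ of $P(n)$ strictly between them, $j-i-1$ (with $j$ taken as the representative in $(i,i+n]$), is $\equiv 0\pmod 4$ (if $M$ has exactly one spoke $u_iv_i$, it is regarded as two consecutive spokes with $j=i+n$, so the number is $n-1$); or (ii) $M$ contains no spoke, $4\mid n$, and for some $i$, $M=\bigcup_{k=0}^{n/4-1}\{u_{i+4k}u_{i+4k+2},\,u_{i+4k+1}u_{i+4k+3},\,v_{i+4k}v_{i+4k+1},\,v_{i+4k+2}v_{i+4k+3}\}$. *)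

(* Defs.v *)
From HB Require Import structures.
From mathcomp Require Import all_boot all_order all_algebra.
Set Implicit Arguments.
Unset Strict Implicit.
Unset Printing Implicit Defensive.

(* A simple graph on T is given by its edge set E, a set of 2-subsets of T. *)
Section Forcing.
Variables (T : finType) (E : {set {set T}}).
Implicit Types M S : {set {set T}}.

Definition perfect_matching M : bool :=
  (M \subset E) && [forall x : T, #|[set e in M | x \in e]| == 1].

Definition forcing_set M S : bool :=
  (S \subset M) &&
  [forall M' : {set {set T}},
     perfect_matching M' && (S \subset M') ==> (M' == M)].

(* A minimum over a nonempty family when M is a perfect matching and set0 is
   not an edge, since then M is a forcing set of itself (forcing_set_refl). *)
Definition forcing_number M : nat :=
  #|[arg min_(S < M | forcing_set M S) #|S|]|.

Lemma forcing_set_refl M :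
  set0 \notin E -> perfect_matching M -> forcing_set M M.
Proof.
move=> E0 /andP[_ /forallP pM]; rewrite /forcing_set subxx /=.
apply/forallP => M'; apply/implyP => /andP[/andP[M'E /forallP pM'] MM'].
rewrite eqEsubset MM' andbT; apply/subsetP => e eM'.
have /set0Pn[x xe] : e != set0.
  by apply: contraNneq E0 => <-; apply: (subsetP M'E).
have /cards1P[f Mf] := pM x; have /cards1P[f' Mf'] := pM' x.
have /setIdP[fM xf] : f \in [set e in M | x \in e] by rewrite Mf set11.
have /set1P -> : e \in [set f'] by rewrite -Mf' inE eM'.
suff /set1P <- : f \in [set f'] by [].
by rewrite -Mf' inE (subsetP MM').
Qed.

Lemma forcing_numberP M :
  set0 \notin E -> perfect_matching M ->
  (exists2 S, forcing_set M S & #|S| = forcing_number M) /\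
  (forall S, forcing_set M S -> forcing_number M <= #|S|).
Proof.
move=> E0 pM; rewrite /forcing_number.
case: arg_minnP => [|S fS minS]; first exact: forcing_set_refl.
by split; first exists S.
Qed.

End Forcing.

Section GeneralizedPetersen.
Variable n : nat.

Definition vertex : finType := ('I_n + 'I_n)%type.
Definition u (i : 'I_n) : vertex := inl i.
Definition v (i : 'I_n) : vertex := inr i.

(* The subscript i + k modulo n. *)
Definition shift (i : 'I_n) (k : nat) : 'I_n :=
  Ordinal (ltn_pmod (i + k) (leq_ltn_trans (leq0n i) (ltn_ord i))).

Definition spoke (i : 'I_n) : {set vertex} := [set u i; v i].

Definition petersen_edges : {set {set vertex}} :=
  [set [set u i; u (shift i 2)] | i : 'I_n]
  :|: [set spoke i | i : 'I_n]
  :|: [set [set v i; v (shift i 1)] | i : 'I_n].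

Implicit Type M : {set {set vertex}}.

(* spoke i and spoke j, for j = i + g + 1, are cyclically consecutive spokes
   of M. As g ranges over 'I_n, j ranges over i + 1, ..., i + n, so that a
   unique spoke of M is consecutive to itself with g = n - 1. *)
Definition consecutive_spokes M (i g : 'I_n) : bool :=
  [&& spoke i \in M, spoke (shift i g.+1) \in M
    & [forall k : 'I_n, (k < g) ==> (spoke (shift i k.+1) \notin M)]].

Definition spoke_gaps_div4 M : bool :=
  [exists i, spoke i \in M] &&
  [forall i, forall g : 'I_n, consecutive_spokes M i g ==> (4 %| g)].

Definition spokeless_matching (i : 'I_n) : {set {set vertex}} :=
  \bigcup_(k < n %/ 4)
    [set [set u (shift i (4 * k)); u (shift i (4 * k + 2))];
         [set u (shift i (4 * k + 1)); u (shift i (4 * k + 3))];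
         [set v (shift i (4 * k)); v (shift i (4 * k + 1))];
         [set v (shift i (4 * k + 2)); v (shift i (4 * k + 3))]].

Definition spokeless_type M : bool :=
  [&& [forall i, spoke i \notin M], 4 %| n
    & [exists i, M == spokeless_matching i]].

Definition M1 : {set {set {set vertex}}} :=
  [set M | perfect_matching petersen_edges M &
           spoke_gaps_div4 M || spokeless_type M].

End GeneralizedPetersen.

(* Main.v *)
Require Import Defs.
From mathcomp Require Import all_boot all_order all_algebra.
From mathcomp Require Import zify lra.
Set Implicit Arguments.
Unset Strict Implicit.
Unset Printing Implicit Defensive.

(** Recording, at each index k, which of u_k v_k, u_k u_{k+2}, v_k v_{k+1} lie
    in a perfect matching turns it into a closed walk of length n in one of two
    automata, distinguished by the parity of the number of matching edges that
    cross a cut. The matchings of M_1(P(n)) are the even walks, i.e. the cyclic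
    tilings of Z/n by single spokes and by blocks of length 4.
    Lower bound: in the all-spoke matching four consecutive spokes can be
    replaced by a block, so a forcing set meets every four consecutive spokes.
    Upper bound: count positions from a spoke followed by a block (or from any
    spoke if there are only spokes), and for each p divisible by 4 force one edge
    of the tile covering p: the spoke itself, or an edge of the block chosen
    according to the offset of p in the block. As a block has length 4, p mod 4
    counts the spokes since the last forced one, and the chosen edge only allows
    its block to be moved in a direction where there is too little room. If
    there is no spoke, one edge of three different kinds is forced. *)

(* Sp is a spoke; Bj stands for the inner and outer edges starting at a non-spoke
   index: both for B0, the inner one for B1, the outer one for B2, none for B3.
   In a walk of stepA, Bj is the position of offset j in a block. *)
Inductive letter := Sp | B0 | B1 | B2 | B3.

Definition is_spoke x := if x is Sp then true else false.
Definition has_inner x := match x with B0 | B1 => true | _ => false end.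
Definition has_outer x := match x with B0 | B2 => true | _ => false end.
Definition is_start x := match x with Sp | B0 => true | _ => false end.

Definition letter_of (s a c : bool) :=
  if s then Sp else
  match a, c with
  | true, true => B0 | true, false => B1
  | false, true => B2 | false, false => B3
  end.

(* stepA: an even number of edges of the matching crosses each cut between
   consecutive indices; stepB: an odd number. *)
Definition stepA x y :=
  match x, y with
  | Sp, Sp | Sp, B0 | B3, Sp | B3, B0 | B0, B1 | B1, B2 | B2, B3 => true
  | _, _ => false
  end.

Definition stepB x y :=
  match x, y with
  | Sp, B2 | B3, B2 | B2, B1 | B1, Sp | B1, B0 | B0, B3 => true
  | _, _ => false
  end.

Definition walk (step : letter -> letter -> bool) (x : nat -> letter) :=
  forall k, step (x k) (x k.+1).

(** * Walks *)

Section WalksA.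
Variable x : nat -> letter.
Hypothesis xA : walk stepA x.

Lemma block_forward k :
  x k = B0 -> [/\ x k.+1 = B1, x k.+2 = B2, x k.+3 = B3 & is_start (x k.+4)].
Proof.
move=> x0; have := xA k; rewrite x0; case E1: (x k.+1) => // _.
have := xA k.+1; rewrite E1; case E2: (x k.+2) => // _.
have := xA k.+2; rewrite E2; case E3: (x k.+3) => // _.
by have := xA k.+3; rewrite E3; case: (x k.+4).
Qed.

Lemma back1 k : x k.+1 = B1 -> x k = B0.
Proof. by move=> e; have := xA k; rewrite e; case: (x k). Qed.

Lemma back2 k : x k.+2 = B2 -> x k = B0.
Proof.
by move=> e; apply: back1; have := xA k.+1; rewrite e; case: (x k.+1).
Qed.

Lemma back3 k : x k.+3 = B3 -> x k = B0.
Proof.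
by move=> e; apply: back2; have := xA k.+2; rewrite e; case: (x k.+2).
Qed.

Lemma start_pred k :
  is_start (x k.+1) -> x k = Sp \/ x k = B3.
Proof. by have := xA k; case: (x k) (x k.+1) => [] []; auto. Qed.

Lemma start_after_spoke k : x k = Sp -> is_start (x k.+1).
Proof. by move=> e; have := xA k; rewrite e; case: (x k.+1). Qed.

(** A spoke at [k.+3] would be preceded by [Sp] or [B3], neither of which has an outer edge, so a
    block ends at [k.+3]. *)
Lemma block_of_end k : has_outer (x k.+2) -> is_start (x k.+4) -> x k = B0.
Proof.
move=> c s; apply: back2; have [e|e] := start_pred s; have := xA k.+2; rewrite e.
  by case: (x k.+2) c.
by case: (x k.+2).
Qed.

Lemma block_before k n :
  x k = B0 -> k < n -> is_start (x n) -> k + 4 <= n.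
Proof.
move=> /block_forward[e1 e2 e3 _] kn.
have [/eqP<-|n1] := boolP (k.+1 == n); first by rewrite e1.
have [/eqP<-|n2] := boolP (k.+2 == n); first by rewrite e2.
have [/eqP<-|n3] := boolP (k.+3 == n); first by rewrite e3.
by move=> _; lia.
Qed.

Lemma block_start k : is_start (x 0) -> ~~ is_spoke (x k) ->
  exists m j, [/\ k = m + j, j < 4 & x m = B0].
Proof.
move=> x0 nsk.
case e: (x k) nsk => [||||] // _.
- by exists k, 0; rewrite addn0.
- case: k e => [|k] e; first by rewrite e in x0.
  by exists k, 1; rewrite addn1; split=> //; apply: back1.
- case: k e => [|[|k]] e; first by rewrite e in x0.
    by have := xA 0; move: x0; rewrite e; case: (x 0).
  by exists k, 2; rewrite addn2; split=> //; apply: back2.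
- case: k e => [|[|[|k]]] e; first by rewrite e in x0.
  + by have := xA 0; move: x0; rewrite e; case: (x 0).
  + by have := xA 0; have := xA 1; move: x0; rewrite e; case: (x 0); case: (x 1).
  by exists k, 3; rewrite addn3; split=> //; apply: back3.
Qed.

End WalksA.

(* x is the given matching, y another one containing the forced edges, both read
   from a forced spoke. Blocks of x starting at k = 1, 2 mod 4 are located in y
   from left to right, those with k = 0, 3 mod 4 from right to left. *)
Section Uniqueness.
Variables (n : nat) (x y : nat -> letter).
Hypotheses (xA : walk stepA x) (yA : walk stepA y).
Hypotheses (x0 : x 0 = Sp) (xn : x n = Sp) (y0 : y 0 = Sp) (yn : y n = Sp).
Hypothesis forced : forall p, 4 %| p -> p < n ->
  match x p with
  | Sp => is_spoke (y p)
  | B3 => has_inner (y (p - 3))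
  | B2 => has_outer (y (p - 2))
  | B1 => has_outer (y p.+1)
  | B0 => has_outer (y p.+2)
  end.

Let start_n : is_start (x n). Proof. by rewrite xn. Qed.

(** Induction from left to right: what is forced at [k - 1] is either a spoke, after which a tile
    starts, or the inner edge at [k - 4], which makes the start at [k - 4] a block ending at
    [k - 1]. *)
Lemma start_mod1 k : k <= n -> k %% 4 = 1 -> is_start (x k) -> is_start (y k).
Proof.
elim/ltn_ind: k => -[|k] IH kn km sx; first by [].
have k4 : 4 %| k by lia.
have := forced k4 kn.
have [e|e] := start_pred xA sx; rewrite e.
  by case e': (y k) => // _; apply: (start_after_spoke yA).
case: k IH kn km sx k4 e => [|[|[|k]]]; [by rewrite x0 | lia | lia |].
move=> IH kn km _ _ /(back3 xA) xk; rewrite !subSS subn0.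
have : is_start (y k) by apply: IH; rewrite ?xk //; lia.
case e: (y k) => // _ _.
by have [] := block_forward yA e.
Qed.

(** Induction from right to left, anchored at the spoke [n]: for a block, the start at [k + 4] and
    the forced outer edge at [k + 2] fix its place. *)
Lemma start_mod0 k : k <= n -> 4 %| k -> is_start (x k) -> is_start (y k).
Proof.
move: {2}(n - k) (leqnn (n - k)) => d; elim: d k => [|d IH] k kd kn km sx.
  by have -> : k = n by [lia]; rewrite yn.
have [->|kn'] := eqVneq k n; first by rewrite yn.
have {}kn : k < n by lia.
have := forced km kn.
case e: (x k) sx => // _; first by case: (y k).
have [_ _ _ s4] := block_forward xA e.
have k4 := block_before xA e kn start_n; rewrite addn4 in k4.
have sy : is_start (y k.+4) by apply: IH; lia.
by move=> /(block_of_end yA)->.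
Qed.

(** The forced outer edge is at [k] itself, so only a start is missing. A preceding block gives it
    by induction; a preceding spoke gives a start of [y] at [k - 1], which is no [B0] since [B1] has
    no outer edge. *)
Lemma block_agree_mod2 k : k < n -> k %% 4 = 2 -> x k = B0 -> y k = B0.
Proof.
elim/ltn_ind: k => -[|k] IH kn km xk; first by [].
have k4 := block_before xA xk kn start_n.
have [_ x2 _ _] := block_forward xA xk.
have p4 : 4 %| k.+3 by lia.
have pn : k.+3 < n by lia.
have := forced p4 pn; rewrite x2 !subSS subn0 => yc.
suff: is_start (y k.+1) by case: (y k.+1) yc.
have sx : is_start (x k.+1) by rewrite xk.
have [e|e] := start_pred xA sx.
  have : is_start (y k) by apply: start_mod1; rewrite ?e //; lia.
  by have := yA k; case: (y k) (y k.+1) yc => [] [].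
case: k IH kn km xk k4 x2 p4 pn yc sx e => [|[|[|k]]]; [lia| |lia|].
  by move=> _ _ _ _ _ _ _ _ _ _ e1; have := xA 0; rewrite x0 e1.
move=> IH kn km _ _ _ _ _ _ _ /(back3 xA) xk.
by have [|||_ _ _ //] := block_forward yA (IH k _ _ _ xk); lia.
Qed.

(** The outer edge forced at [k + 2] leaves [B2], as wanted, or [B0], a block moved right by two.
    The latter conflicts with what [x] has at [k + 4]: the end [n], a spoke (then [k + 5] is a
    start) or a block (by induction). *)
Lemma block_agree_mod3 k : k < n -> k %% 4 = 3 -> x k = B0 -> y k = B0.
Proof.
move: {2}(n - k) (leqnn (n - k)) => d; elim: d k => [|d IH] k kd kn km xk; first lia.
have k4 := block_before xA xk kn start_n; rewrite addn4 in k4.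
have [x1 _ _ s4] := block_forward xA xk.
have p4 : 4 %| k.+1 by lia.
have := forced p4 (ltac:(lia) : k.+1 < n); rewrite x1 => yc.
apply: (back2 yA).
case e2: (y k.+2) yc => // _.
have [_ _ e5 _] := block_forward yA e2; have [_ e4 _ _] := block_forward yA e2.
have [en|kn4] := eqVneq k.+4 n; first by rewrite en yn in e4.
case e: (x k.+4) s4 => // _.
  have : is_start (y k.+4.+1).
    by apply: start_mod0; [lia|lia|apply: (start_after_spoke xA)].
  by rewrite e5.
by have := IH k.+4 (ltac:(lia)) (ltac:(lia)) (ltac:(lia)) e; rewrite e4.
Qed.

Lemma block_agree k : k < n -> x k = B0 -> y k = B0.
Proof.
move=> kn xk; have k4 := block_before xA xk kn start_n.
have [x1 x2 x3 _] := block_forward xA xk.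
have sx : is_start (x k) by rewrite xk.
have : [\/ k %% 4 = 0, k %% 4 = 1, k %% 4 = 2 | k %% 4 = 3].
  by have := ltn_pmod k (isT : 0 < 4); case: (k %% 4) => [|[|[|[|]]]] // _;
    [constructor 1 | constructor 2 | constructor 3 | constructor 4].
case=> km; [| | exact: block_agree_mod2 | exact: block_agree_mod3].
- have p4 : 4 %| k by lia.
  have := forced p4 kn; rewrite xk => /(block_of_end yA); apply.
  rewrite addn4 in k4; apply: start_mod0; [lia | lia |].
  by have [] := block_forward xA xk.
- have p4 : 4 %| k.+3 by lia.
  have pn : k.+3 < n by lia.
  have := forced p4 pn; rewrite x3 !subSS subn0.
  by have := start_mod1 (ltnW kn) km sx; case: (y k).
Qed.

Lemma letter_in_block z m j : walk stepA z -> z m = B0 -> j < 4 ->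
  z (m + j) = nth Sp [:: B0; B1; B2; B3] j.
Proof.
move=> zA zm; have [z1 z2 z3 _] := block_forward zA zm.
by case: j => [|[|[|[|j]]]] // _; rewrite ?addn0 ?addn1 ?addn2 ?addn3.
Qed.

Lemma walk_agree k : k < n -> y k = x k.
Proof.
move=> kn; have [sx|nsx] := boolP (is_spoke (x k)); last first.
  have [|m [j [e j4 xm]]] := block_start xA _ nsx; first by rewrite x0.
  have ym : y m = B0 by apply: block_agree => //; lia.
  by rewrite e !letter_in_block.
have [sy|nsy] := boolP (is_spoke (y k)); first by case: (x k) (y k) sx sy => [] [].
(* Otherwise a block of [y] covers [k]. It contains a multiple of 4, where a spoke of [x] would be
   forced in [y]; so [x] has a block there, which must be the same one and covers [k] too. *)
have [|m [j [e j4 ym]]] := block_start yA _ nsy; first by rewrite y0.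
have m4 : m + 4 <= n by apply: (block_before yA ym); rewrite ?yn //; lia.
have [i i4 pm] : exists2 i, i < 4 & 4 %| m + i.
  by exists ((4 - m %% 4) %% 4); lia.
have yp := letter_in_block yA ym i4.
have := forced pm (ltac:(lia) : m + i < n).
have [sp|nsp] := boolP (is_spoke (x (m + i))).
  by case: (x (m + i)) sp => // _; rewrite yp; move: i4; clear; case: i => [|[|[|[]]]].
move=> _; have [|m' [i' [e' i'4 xm']]] := block_start xA _ nsp; first by rewrite x0.
have ym' : y m' = B0 by apply: block_agree => //; lia.
have := letter_in_block yA ym' i'4; rewrite -e' yp => ei.
have ii : i = i'.
  by move: i4 i'4 ei; clear; case: i => [|[|[|[|i]]]] // _; case: i' => [|[|[|[|i']]]].
have mm : m = m' by lia.
have := letter_in_block xA xm' j4; rewrite -mm -e => xk.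
by move: sx j4; rewrite xk; clear; case: j => [|[|[|[]]]].
Qed.

End Uniqueness.

(* The three forced kinds of edges have no common phase in a spokeless walk of
   stepB; spokes shift the phase forward, but never back to close the walk. *)
Lemma spokeless_agree (t : nat) (y : nat -> letter) :
  2 < t -> walk stepA y \/ walk stepB y -> y (4 * t) = y 0 -> y (4 * t).+1 = y 1 ->
  has_inner (y 1) -> has_inner (y 4) ->
  (forall j, 1 < j < t -> has_outer (y (4 * j))) ->
  forall j, j < t -> y (4 * j) = B0.
Proof.
move=> t2 [yA|yB] per per1 a1 a4 cs.
  have e0 : y 0 = B0.
    apply: (back1 yA); case e: (y 1) a1 => // _.
    by have [_ _ e4 _] := block_forward yA e; rewrite e4 in a4.
  elim=> [|j IH] jt; first by rewrite muln0.
  have [_ _ _] := block_forward yA (IH (ltnW jt)).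
  have -> : (4 * j).+4 = 4 * j.+1 by lia.
  case: j {IH} jt => [|j] jt; first by rewrite muln1; case: (y 4) a4.
  by have := cs j.+2 jt; case: (y _).
(* In [stepB] the letters run [B0], [B3], [B2], [B1], where one spoke may replace [B0], [B3]. With
   [B1] at 4, the outer edge at 8 needs such a spoke. *)
have e4 : y 4 = B1.
  move: a1 a4; have := yB 1; have := yB 2; have := yB 3.
  by case: (y 1) (y 2) (y 3) (y 4) => [] [] [] [].
have e8 : y 8 = B0.
  have := cs 2 t2; have := yB 4; have := yB 5; have := yB 6; have := yB 7.
  by rewrite e4; case: (y 5) (y 6) (y 7) (y 8) => [] [] [] [].
(* Four steps from [B0] lead to a start, so [4 * t], that is index 0, is a start; but no start
   precedes an inner edge in [stepB]. *)
have start j : 1 < j <= t -> [\/ j = 2 | is_start (y (4 * j)) ].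
  elim: j => // j IH jt; have [->|j2] := eqVneq j 1; first by left.
  right; have yj : y (4 * j) = B0.
    case: IH => [|->//|]; first lia.
    by have := cs j (ltac:(lia)); case: (y (4 * j)).
  have -> : 4 * j.+1 = (4 * j).+4 by lia.
  have := yB (4 * j); have := yB (4 * j).+1; have := yB (4 * j).+2.
  have := yB (4 * j).+3; rewrite yj.
  by case: (y (4 * j).+1) (y (4 * j).+2) (y (4 * j).+3) (y (4 * j).+4) => [] [] [] [].
exfalso; case: (start t) => [|et|]; [lia|lia|rewrite per => s0].
by have := yB 0; case: (y 0) (y 1) s0 a1 => [] [].
Qed.

(** Between spokes [stepB] repeats [B2], [B1], [B0], [B3], so position [g] holds [Sp] or [B3], both
    followed by [B2]. This excludes odd walks when the gaps are divisible by 4. *)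
Lemma classB_gap (x : nat -> letter) g :
  walk stepB x -> x 0 = Sp -> 4 %| g -> (forall k, k < g -> ~~ is_spoke (x k.+1)) ->
  ~~ is_spoke (x g.+1).
Proof.
move=> xB x0 /dvdnP[m ->] ns.
suff: x (m * 4) = Sp \/ x (m * 4) = B3.
  by have := xB (m * 4); case: (x (m * 4).+1) => // + [] e; rewrite e.
elim: m ns => [|m IH] ns; first by left.
have := ns (m * 4) ltac:(lia); have := ns (m * 4).+1 ltac:(lia).
have := ns (m * 4).+2 ltac:(lia); have := ns (m * 4).+3 ltac:(lia).
have -> : m.+1 * 4 = (m * 4).+4 by lia.
have := xB (m * 4); have := xB (m * 4).+1; have := xB (m * 4).+2.
have := xB (m * 4).+3.
case: IH => [k kg|->|->]; first by apply: ns; lia.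
all: case: (x (m * 4).+1) (x (m * 4).+2) (x (m * 4).+3) (x (m * 4).+4) => [] [] [] [] //; auto.
Qed.

(** * Perfect matchings of P(n) as walks *)

Section Petersen.
Variable n : nat.
Hypothesis n9 : 9 <= n.
Implicit Types (i j : 'I_n) (M S : {set {set vertex n}}) (e : {set vertex n}).

Definition inner j := [set u j; u (shift j 2)].
Definition outer j := [set v j; v (shift j 1)].

Lemma shift_shift j a b : shift (shift j a) b = shift j (a + b).
Proof. by apply: val_inj; rewrite /= modnDml addnA. Qed.

Lemma shift_add_n j k : shift j (k + n) = shift j k.
Proof. by apply: val_inj; rewrite /= addnA modnDr. Qed.

Lemma shift0 j : shift j 0 = j.
Proof. by apply: val_inj; rewrite /= addn0 modn_small. Qed.

Lemma shift_n j : shift j n = j.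
Proof. by rewrite -[n in shift j n]add0n shift_add_n shift0. Qed.

Lemma shift_onto i j : exists2 k, k < n & j = shift i k.
Proof.
exists ((j + (n - i)) %% n); first by rewrite ltn_pmod //; lia.
apply: val_inj; rewrite /= modnDmr addnCA subnKC ?modnDr ?modn_small //.
exact: ltnW.
Qed.

Lemma shift_inj k : injective (fun j => shift j k).
Proof.
move=> i j /(congr1 val) /= /eqP; rewrite eqn_modDr !modn_small // => /eqP.
exact: val_inj.
Qed.

Lemma shift_eq j a b : (shift j a == shift j b) = (a == b %[mod n]).
Proof. by rewrite -val_eqE /= eqn_modDl. Qed.

Lemma shift_eq_small j a b : a < n -> b < n -> (shift j a == shift j b) = (a == b).
Proof. by move=> an bn; rewrite shift_eq (modn_small an) (modn_small bn). Qed.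

Lemma shift_neq j a : 0 < a < n -> (shift j a == j) = false.
Proof.
case/andP=> a0 an; rewrite -{2}(shift0 j) shift_eq_small ?(ltn_trans a0) //.
exact: gtn_eqF.
Qed.

Lemma u_in_spoke i j : (u i \in spoke j) = (i == j).
Proof. by rewrite !inE orbF. Qed.
Lemma v_in_spoke i j : (v i \in spoke j) = (i == j).
Proof. by rewrite !inE. Qed.
Lemma u_in_inner i j : (u i \in inner j) = (i == j) || (i == shift j 2).
Proof. by rewrite !inE. Qed.
Lemma v_in_inner i j : (v i \in inner j) = false.
Proof. by rewrite !inE. Qed.
Lemma u_in_outer i j : (u i \in outer j) = false.
Proof. by rewrite !inE. Qed.
Lemma v_in_outer i j : (v i \in outer j) = (i == j) || (i == shift j 1).
Proof. by rewrite !inE. Qed.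
Let memE := (u_in_spoke, v_in_spoke, u_in_inner, v_in_inner, u_in_outer, v_in_outer).

Lemma spoke_inj : injective (@spoke n).
Proof. by move=> i j /setP/(_ (u i)); rewrite !memE eqxx => /esym/eqP. Qed.

Lemma inner_inj : injective inner.
Proof.
move=> i j /setP E; have := E (u i); rewrite !memE eqxx => /esym/orP[/eqP//|/eqP ij].
have := E (u (shift i 2)); rewrite !memE eqxx orbT ij shift_shift => /esym.
by rewrite shift_eq_small ?shift_neq //=; lia.
Qed.

Lemma outer_inj : injective outer.
Proof.
move=> i j /setP E; have := E (v i); rewrite !memE eqxx => /esym/orP[/eqP//|/eqP ij].
have := E (v (shift i 1)); rewrite !memE eqxx orbT ij shift_shift => /esym.
by rewrite shift_eq_small ?shift_neq //=; lia.
Qed.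

Lemma spoke_inner i j : (spoke i == inner j) = false.
Proof. by apply/eqP => /setP/(_ (v i)); rewrite !memE eqxx. Qed.
Lemma spoke_outer i j : (spoke i == outer j) = false.
Proof. by apply/eqP => /setP/(_ (u i)); rewrite !memE eqxx. Qed.
Lemma inner_outer i j : (inner i == outer j) = false.
Proof. by apply/eqP => /setP/(_ (u i)); rewrite !memE eqxx. Qed.

Lemma edgeP e : reflect (exists j, [\/ e = spoke j, e = inner j | e = outer j])
                        (e \in petersen_edges n).
Proof.
rewrite !inE; apply: (iffP idP) => [/orP[/orP[]|] /imsetP[j _ ->]|].
- by exists j; constructor 2.
- by exists j; constructor 1.
- by exists j; constructor 3.
- by case=> j [] ->; rewrite !imset_f ?orbT.
Qed.

Lemma card_edges_at M x e1 e2 e3 :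
  M \subset petersen_edges n -> uniq [:: e1; e2; e3] ->
  (forall e, e \in petersen_edges n -> (x \in e) = (e \in [:: e1; e2; e3])) ->
  #|[set e in M | x \in e]| = (e1 \in M) + (e2 \in M) + (e3 \in M).
Proof.
move=> ME ue inc.
have -> : [set e in M | x \in e] = [set e in [seq e <- [:: e1; e2; e3] | e \in M]].
  apply/setP => e; rewrite !inE mem_filter.
  by case: (boolP (e \in M)) => //= eM; rewrite (inc e (subsetP ME e eM)) !inE.
rewrite cardsE (card_uniqP _) ?filter_uniq // size_filter /=; lia.
Qed.

(** The subscript [j] + 2 lets the other inner edge start at [j], without subtraction modulo [n]. *)
Lemma card_edges_at_u M j : M \subset petersen_edges n ->
  #|[set e in M | u (shift j 2) \in e]|
  = (spoke (shift j 2) \in M) + (inner (shift j 2) \in M) + (inner j \in M).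
Proof.
move=> ME; apply: card_edges_at => //.
  rewrite /= !inE !spoke_inner (inj_eq inner_inj) shift_neq //; lia.
move=> e /edgeP[i [] ->]; rewrite !memE !inE ?(inj_eq spoke_inj) ?(inj_eq inner_inj)
  ?(inj_eq (@shift_inj 2)) ?spoke_inner ?[inner i == _]eq_sym ?spoke_inner
  ?[outer i == _]eq_sym ?spoke_outer ?inner_outer ?orbF //= 1?eq_sym //.
by rewrite ![i == _]eq_sym.
Qed.

Lemma card_edges_at_v M j : M \subset petersen_edges n ->
  #|[set e in M | v (shift j 1) \in e]|
  = (spoke (shift j 1) \in M) + (outer (shift j 1) \in M) + (outer j \in M).
Proof.
move=> ME; apply: card_edges_at => //.
  rewrite /= !inE !spoke_outer (inj_eq outer_inj) shift_neq //; lia.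
move=> e /edgeP[i [] ->]; rewrite !memE !inE ?(inj_eq spoke_inj) ?(inj_eq outer_inj)
  ?(inj_eq (@shift_inj 1)) ?spoke_outer ?[outer i == _]eq_sym ?spoke_outer
  ?inner_outer ?[inner i == spoke _]eq_sym ?spoke_inner ?orbF //= 1?eq_sym //.
by rewrite ![i == _]eq_sym.
Qed.

Lemma perfect_matchingP M : reflect
  (M \subset petersen_edges n /\ forall j,
    (spoke (shift j 2) \in M) + (inner (shift j 2) \in M) + (inner j \in M) = 1 /\
    (spoke (shift j 1) \in M) + (outer (shift j 1) \in M) + (outer j \in M) = 1)
  (perfect_matching (petersen_edges n) M).
Proof.
apply: (iffP andP) => -[ME pM]; split=> //.
  move=> j; rewrite -card_edges_at_u // -card_edges_at_v //.
  by split; apply/eqP; apply: (forallP pM).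
apply/forallP => -[] j.
- have -> : inl j = u (shift (shift j (n - 2)) 2).
    by rewrite shift_shift subnK ?shift_n //; lia.
  by rewrite card_edges_at_u // (pM _).1.
- have -> : inr j = v (shift (shift j (n - 1)) 1).
    by rewrite shift_shift subnK ?shift_n //; lia.
  by rewrite card_edges_at_v // (pM _).2.
Qed.

Definition letter_at M j :=
  letter_of (spoke j \in M) (inner j \in M) (outer j \in M).

(** Moving the cut past index 2 drops [a0] and [c1] and adds [a2] and [c2]; both [a0 (+) a2] and
    [c1 (+) c2] equal [~~ s]. *)
Lemma crossing_step (s a0 a1 a2 c1 c2 : bool) :
  s + a2 + a0 = 1 -> s + c2 + c1 = 1 -> a0 (+) a1 (+) c1 = a1 (+) a2 (+) c2.
Proof. by case: s a0 a1 a2 c1 c2 => [] [] [] [] [] []. Qed.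

(** The condition at the inner vertex of index 2 expresses [a0] through [s2] and [a2], so the parity
    relates the letters at indices 1 and 2. *)
Lemma letter_step (s1 s2 a0 a1 a2 a3 c0 c1 c2 b : bool) :
  s2 + a2 + a0 = 1 -> s2 + c2 + c1 = 1 -> s1 + c1 + c0 = 1 -> s1 + a1 + a3 = 1 ->
  a0 (+) a1 (+) c1 = b ->
  (if b then stepB else stepA) (letter_of s1 a1 c1) (letter_of s2 a2 c2).
Proof. by case: s1 s2 a0 a1 a2 c1 c2 => [] [] [] [] [] [] [] //; case: b a3 c0 => [] [] []. Qed.

Section Letters.
Variable M : {set {set vertex n}}.
Hypothesis pM : perfect_matching (petersen_edges n) M.

Let count j := ((perfect_matchingP M pM).2 j).

(** [letter_of] forgets [a] and [c] at a spoke, where the vertex conditions make both false. *)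
Lemma letter_atE j :
  [/\ is_spoke (letter_at M j) = (spoke j \in M),
      has_inner (letter_at M j) = (inner j \in M)
    & has_outer (letter_at M j) = (outer j \in M)].
Proof.
have [c1 _] := count (shift j (n - 2)); have [_ c2] := count (shift j (n - 1)).
rewrite !shift_shift !subnK ?shift_n in c1 c2; try lia.
rewrite /letter_at; move: c1 c2.
by case: (spoke j \in M) (inner j \in M) (outer j \in M) => [] [] [].
Qed.

(** The parity of the matching edges across the cut between [j] + 1 and [j] + 2. *)
Let crossing j :=
  (inner j \in M) (+) (inner (shift j 1) \in M) (+) (outer (shift j 1) \in M).

Lemma crossing_const i j : crossing i = crossing j.
Proof.
have [k _ ->] := shift_onto i j; elim: k => [|k ->]; first by rewrite shift0.
move: (shift i k) (shift_shift i k 1) => j'; rewrite addn1 => <-.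
have [c1 _] := count j'; have [_ c2] := count (shift j' 1).
rewrite !shift_shift in c2.
by rewrite /crossing !shift_shift; apply: crossing_step c1 c2.
Qed.

Lemma letter_walk :
  (forall i, walk stepA (fun k => letter_at M (shift i k))) \/
  (forall i, walk stepB (fun k => letter_at M (shift i k))).
Proof.
have cnt i k : exists j, shift i k = shift j 1 /\ shift i k.+1 = shift j 2.
  exists (shift i (k + (n - 1))); rewrite !shift_shift.
  have -> : k + (n - 1) + 1 = k + n by lia.
  have -> : k + (n - 1) + 2 = k.+1 + n by lia.
  by rewrite !shift_add_n.
have j0 : 'I_n by exists 0; lia.
have n12 : n - 1 + 2 = 1 + n by lia.
case e: (crossing j0); [right | left] => i k; have [j [-> ->]] := cnt i k;
  have := crossing_const j j0; rewrite e /crossing /letter_at.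
all: have [c1 c2] := count j; have [_ c3] := count (shift j 1).
all: have [c4 _] := count (shift j (n - 1)).
all: rewrite shift_shift in c3; rewrite shift_shift n12 shift_add_n in c4.
all: move=> cr; exact: letter_step c1 c3 c2 c4 cr.
Qed.

End Letters.

(** * Matchings built from closed walks of [stepA] *)

Section LetterMatching.
Variable f : 'I_n -> letter.
Hypothesis fA : forall j, stepA (f j) (f (shift j 1)).

Definition letter_matching :=
  [set spoke j | j in [pred j | is_spoke (f j)]] :|:
  [set inner j | j in [pred j | has_inner (f j)]] :|:
  [set outer j | j in [pred j | has_outer (f j)]].

Lemma spoke_letter_matching j : (spoke j \in letter_matching) = is_spoke (f j).
Proof.
rewrite !inE mem_imset ?inE; last exact: spoke_inj.
rewrite orbC [X in X || _](negPf _) /=.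
  by rewrite orbC [X in X || _](negPf _) //; apply/imsetP=> -[i _ /eqP]; rewrite spoke_inner.
by apply/imsetP=> -[i _ /eqP]; rewrite spoke_outer.
Qed.

Lemma inner_letter_matching j : (inner j \in letter_matching) = has_inner (f j).
Proof.
rewrite !inE [inner j \in inner @: _]mem_imset ?inE; last exact: inner_inj.
rewrite orbC [X in X || _](negPf _) /=.
  by rewrite [X in X || _](negPf _) //; apply/imsetP=> -[i _ /eqP]; rewrite eq_sym spoke_inner.
by apply/imsetP=> -[i _ /eqP]; rewrite inner_outer.
Qed.

Lemma outer_letter_matching j : (outer j \in letter_matching) = has_outer (f j).
Proof.
rewrite !inE [outer j \in outer @: _]mem_imset ?inE; last exact: outer_inj.
rewrite -orbA [X in X || _](negPf _) /=.
  by rewrite [X in X || _](negPf _) //; apply/imsetP=> -[i _ /eqP]; rewrite eq_sym inner_outer.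
by apply/imsetP=> -[i _ /eqP]; rewrite eq_sym spoke_outer.
Qed.

Lemma letter_matching_perfect : perfect_matching (petersen_edges n) letter_matching.
Proof.
apply/perfect_matchingP; split.
  apply/subsetP=> e /setUP[/setUP[]|] /imsetP[j _ ->]; apply/edgeP; exists j.
  - by constructor 1.
  - by constructor 2.
  - by constructor 3.
move=> j; rewrite !spoke_letter_matching !inner_letter_matching !outer_letter_matching.
have := fA j; have := fA (shift j 1); rewrite shift_shift.
by case: (f j) (f (shift j 1)) (f (shift j (1 + 1))) => [] [] [].
Qed.

End LetterMatching.

(** * The all-spoke matching *)

Definition all_spokes := [set spoke j | j : 'I_n].

Lemma all_spokes_perfect : perfect_matching (petersen_edges n) all_spokes.
Proof.
rewrite (_ : all_spokes = letter_matching (fun=> Sp)); first exact: letter_matching_perfect.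
apply/setP => e; rewrite !inE -[RHS]orbA [X in _ = _ || X](_ : _ = false).
  by rewrite orbF.
by apply/negbTE; rewrite negb_or; apply/andP; split; apply/imsetP => -[].
Qed.

Lemma all_spokes_M1 : all_spokes \in M1 n.
Proof.
rewrite inE all_spokes_perfect; apply/orP; left; apply/andP; split.
  have j0 : 'I_n by exists 0; lia.
  by apply/existsP; exists j0; rewrite imset_f.
apply/forallP => i; apply/forallP => g; apply/implyP => /and3P[_ _ /forallP gap].
(* All gaps are 0: a positive [g] would forbid the spoke at [i] + 1, the instance 0 of [gap]. *)
case: (posnP g) => [-> //|g0].
by have := gap (Ordinal (leq_ltn_trans (leq0n i) (ltn_ord i))); rewrite /= g0 imset_f.
Qed.

(* All spokes, except for a block on i, ..., i + 3. *)
Definition swapped_letter i j := nth Sp [:: B0; B1; B2; B3] ((j + (n - i)) %% n).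

Lemma swapped_letterE i k : swapped_letter i (shift i k) = nth Sp [:: B0; B1; B2; B3] (k %% n).
Proof.
rewrite /swapped_letter /= modnDml; congr nth.
by rewrite addnAC subnKC ?modnDl //; apply: ltnW.
Qed.

Lemma swapped_letter_step i j : stepA (swapped_letter i j) (swapped_letter i (shift j 1)).
Proof.
have [k kn ->] := shift_onto i j; rewrite shift_shift !swapped_letterE modn_small // addn1.
(* At the wrap-around the default [Sp] of [nth] is followed by [B0]. *)
have [kn'|kn'] := eqVneq k.+1 n.
  by rewrite kn' modnn nth_default //=; lia.
rewrite modn_small; last lia.
by case: k {kn kn'} => [|[|[|[|k]]]] //=; rewrite !nth_nil.
Qed.

Lemma forcing_set_all_spokes S i :
  forcing_set (petersen_edges n) all_spokes S ->
  exists2 k, k < 4 & spoke (shift i k) \in S.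
Proof.
case/andP=> SM /forallP force.
pose M := letter_matching (swapped_letter i).
have pM : perfect_matching (petersen_edges n) M.
  exact/letter_matching_perfect/swapped_letter_step.
have [/hasP[k]|/hasPn none] := boolP (has (fun k => spoke (shift i k) \in S) (iota 0 4)).
  by rewrite mem_iota => k4; exists k.
have SM' : S \subset M.
  apply/subsetP => e eS; have /imsetP[j _ ej] := subsetP SM e eS.
  have [k kn jk] := shift_onto i j; rewrite ej spoke_letter_matching jk swapped_letterE.
  rewrite modn_small //; have [k4|k4] := ltnP k 4; last by rewrite nth_default.
  by have := none k; rewrite mem_iota -jk -ej eS => /(_ k4).
have := force M; rewrite pM SM' => /eqP ME.
have : spoke i \in M by rewrite ME imset_f.
by rewrite spoke_letter_matching -{2}(shift0 i) swapped_letterE mod0n.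
Qed.

(** Double counting: each of the [n] windows of four indices meets [S], and each spoke lies in four
    windows. *)
Lemma forcing_set_all_spokes_card S :
  forcing_set (petersen_edges n) all_spokes S -> n <= 4 * #|S|.
Proof.
move=> fS.
apply: (@leq_trans (\sum_(i < n) 1)); first by rewrite sum1_card card_ord.
apply: (@leq_trans (\sum_(i < n) \sum_(k < 4) (spoke (shift i k) \in S))).
  apply: leq_sum => i _; have [k k4 kS] := forcing_set_all_spokes i fS.
  by rewrite (bigD1 (Ordinal k4)) //= kS.
rewrite exchange_big /=.
apply: leq_trans (_ : \sum_(k < 4) #|S| <= _); last by rewrite sum_nat_const card_ord.
apply: leq_sum => k _.
rewrite (reindex_inj (@shift_inj (n - k))) /=.
rewrite (eq_bigr (fun i => (spoke i \in S) : nat)) => [|i _]; last first.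
  by rewrite shift_shift subnK ?shift_n //; have := ltn_ord k; lia.
rewrite -big_mkcond sum1_card -(card_imset _ spoke_inj); apply: subset_leq_card.
by apply/subsetP => e /imsetP[i iS ->].
Qed.

(** * Forcing sets of small cardinality *)

Lemma set0_not_edge : set0 \notin petersen_edges n.
Proof.
apply/negP => /edgeP[j [] /setP E]; [have := E (u j) | have := E (u j) | have := E (v j)];
  by rewrite in_set0 !memE eqxx.
Qed.

Lemma perfect_matching_sub M M' :
  perfect_matching (petersen_edges n) M -> perfect_matching (petersen_edges n) M' ->
  M \subset M' -> M' = M.
Proof.
move=> pM pM' MM'; have /andP[_ /forallP/(_ M')] := forcing_set_refl set0_not_edge pM.
by rewrite pM' MM' => /eqP.
Qed.

Lemma letters_sub M M' i :
  perfect_matching (petersen_edges n) M -> perfect_matching (petersen_edges n) M' ->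
  (forall k, k < n -> letter_at M' (shift i k) = letter_at M (shift i k)) -> M \subset M'.
Proof.
move=> pM pM' eqL; have [ME _] := perfect_matchingP M pM.
apply/subsetP => e eM; have /edgeP[j ej] := subsetP ME e eM.
have [k kn jk] := shift_onto i j; have := eqL k kn; rewrite -jk => eqj.
have [s a c] := letter_atE pM j; have [s' a' c'] := letter_atE pM' j.
by move: eM; case: ej => ->; rewrite -1?s -1?a -1?c -1?s' -1?a' -1?c' eqj.
Qed.

Lemma forcing_number_le M m (e : nat -> {set vertex n}) :
  perfect_matching (petersen_edges n) M ->
  (forall k : nat, k < m -> e k \in M) ->
  (forall M', perfect_matching (petersen_edges n) M' ->
     (forall k : nat, k < m -> e k \in M') -> M \subset M') ->
  forcing_number (petersen_edges n) M <= m.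
Proof.
move=> pM eM force; have [_ minM] := forcing_numberP set0_not_edge pM.
apply: (@leq_trans #|[set e j | j : 'I_m]|); last first.
  by rewrite -[leqRHS]card_ord; apply: leq_imset_card.
apply: minM; apply/andP; split.
  by apply/subsetP => _ /imsetP[j _ ->]; apply: eM.
apply/forallP => M'; apply/implyP => /andP[pM' /subsetP SM'].
apply/eqP/perfect_matching_sub => //; apply: force => // j jm.
by apply: SM'; apply/imsetP; exists (Ordinal jm).
Qed.

Lemma forcing_number_spoke M i :
  perfect_matching (petersen_edges n) M ->
  walk stepA (fun k => letter_at M (shift i k)) ->
  spoke i \in M ->
  letter_at M (shift i 1) = B0 \/ (forall j, letter_at M j = Sp) ->
  forcing_number (petersen_edges n) M <= (n + 3) %/ 4.
Proof.
move=> pM; set x := fun k => _ => xA iM x1.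
have x0 : x 0 = Sp by rewrite /x shift0 /letter_at iM.
have xn : x n = Sp by rewrite /x shift_n /letter_at iM.
pose mark p := match x p with
  | Sp => spoke (shift i p)
  | B3 => inner (shift i (p - 3))
  | B2 => outer (shift i (p - 2))
  | B1 => outer (shift i p.+1)
  | B0 => outer (shift i p.+2)
  end.
apply: (@forcing_number_le _ _ (fun j : nat => mark (4 * j))) => // [j jm|M' pM' eM'].
  rewrite /mark; case e: (x (4 * j)).
  - by have [<- _ _] := letter_atE pM (shift i (4 * j)); rewrite -/(x _) e.
  - have [_ _ <-] := letter_atE pM (shift i (4 * j).+2); rewrite -/(x _).
    by have [_ ->] := block_forward xA e.
  - have [_ _ <-] := letter_atE pM (shift i (4 * j).+1); rewrite -/(x _).
    by have := xA (4 * j); rewrite e; case: (x _.+1).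
  (* As position 0 is a spoke, the subtractions in [mark] are never truncated. *)
  - case: j {jm} e => [|j]; first by rewrite x0.
    rewrite (_ : 4 * j.+1 = (4 * j).+2.+2) ?subSS ?subn0 => [|]; last lia.
    move=> /(back2 xA) e.
    by have [_ _ <-] := letter_atE pM (shift i (4 * j).+2); rewrite -/(x _) e.
  - case: j {jm} e => [|j]; first by rewrite x0.
    rewrite (_ : 4 * j.+1 = (4 * j).+1.+3) ?subSS ?subn0 => [|]; last lia.
    move=> /(back3 xA) e.
    by have [_ <- _] := letter_atE pM (shift i (4 * j).+1); rewrite -/(x _) e.
pose y k := letter_at M' (shift i k).
have forced p : 4 %| p -> p < n ->
  match x p with
  | Sp => is_spoke (y p)
  | B3 => has_inner (y (p - 3))
  | B2 => has_outer (y (p - 2))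
  | B1 => has_outer (y p.+1)
  | B0 => has_outer (y p.+2)
  end.
  move=> p4 pn; have := eM' (p %/ 4) ltac:(lia).
  rewrite mulnC divnK // /mark /y.
  by case: (x p); [have [-> _ _] := letter_atE pM' (shift i p)
    | have [_ _ ->] := letter_atE pM' (shift i p.+2)
    | have [_ _ ->] := letter_atE pM' (shift i p.+1)
    | have [_ _ ->] := letter_atE pM' (shift i (p - 2))
    | have [_ -> _] := letter_atE pM' (shift i (p - 3))].
have y0 : y 0 = Sp.
  by have := forced 0 isT ltac:(lia); rewrite x0; case: (y 0).
have yn : y n = Sp by rewrite -y0 /y shift_n shift0.
have [yA|yB] := letter_walk pM'.
  by apply: (@letters_sub _ _ i) => // k; apply: (walk_agree xA (yA i)).
(* An odd walk from [Sp] goes to [B2], which lacks the inner edge forced at 1 if a block follows; if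
   all letters are spokes, it has no spoke at 4. *)
exfalso; have := yB i 0; have := yB i 1; have := yB i 2; have := yB i 3.
have := forced 4 isT ltac:(lia); rewrite -/(y 0) -/(y 1) -/(y 2) -/(y 3) -/(y 4) y0.
case: x1 => [x1|xS]; last first.
  by rewrite /x xS; case: (y 1) (y 2) (y 3) (y 4) => [] [] [] [].
have [_ _ -> _] := block_forward xA x1.
by case: (y 1).
Qed.

Lemma forcing_number_spokeless M i t :
  perfect_matching (petersen_edges n) M -> n = 4 * t ->
  (forall k : nat, k < t -> letter_at M (shift i (4 * k)) = B0) ->
  walk stepA (fun k => letter_at M (shift i k)) ->
  forcing_number (petersen_edges n) M <= t.
Proof.
move=> pM nt; set x := fun k => letter_at M (shift i k) => x4 xA.
have t2 : 2 < t by lia.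
(* One edge per block; since [t] > 2, all three kinds occur: inner at offsets 1 and 0, outer at
   offset 0. *)
pose mark (j : nat) := match j with
  | 0 => inner (shift i 1) | 1 => inner (shift i 4) | _ => outer (shift i (4 * j)) end.
apply: (@forcing_number_le _ _ mark) => // [j jt|M' pM' eM'].
  case: j jt => [|[|j]] jt /=.
  - have [_ <- _] := letter_atE pM (shift i 1); rewrite -/(x _).
    by have [-> _ _ _] := block_forward xA (x4 0 ltac:(lia)).
  - by have [_ <- _] := letter_atE pM (shift i 4); rewrite (x4 1).
  - by have [_ _ <-] := letter_atE pM (shift i (4 * j.+2)); rewrite x4.
pose y k := letter_at M' (shift i k).
have yw : walk stepA y \/ walk stepB y by case: (letter_walk pM') => w; [left | right]; apply: w.
have a1 : has_inner (y 1).
  by have [_ -> _] := letter_atE pM' (shift i 1); apply: (eM' 0); lia.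
have y4 : forall k : nat, k < t -> y (4 * k) = B0.
  apply: (spokeless_agree t2 yw) => //.
  - by rewrite /y -nt shift_n shift0.
  - by rewrite /y -nt -[n.+1]/(1 + n) shift_add_n.
  - by have [_ -> _] := letter_atE pM' (shift i 4); apply: (eM' 1); lia.
  - move=> [|[|j]] // /andP[_ jt].
    by have [_ _ ->] := letter_atE pM' (shift i (4 * j.+2)); apply: (eM' j.+2).
have yA : walk stepA y.
  case: yw => // yB; have := yB 0; have := y4 0 ltac:(lia); rewrite muln0 => ->.
  by case: (y 1) a1.
apply: (@letters_sub _ _ i) => // k kn; rewrite -/(y k) -/(x k).
have kE : k = 4 * (k %/ 4) + k %% 4 by lia.
have k4 : k %/ 4 < t by lia.
by rewrite kE (letter_in_block yA (y4 _ k4)) ?(letter_in_block xA (x4 _ k4)) // ltn_pmod.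
Qed.

(** The inner edge at offset 1 serves to exclude [stepB], where [B0] is followed by [B3]. *)
Lemma spokeless_letters i (j : nat) : 4 %| n ->
  perfect_matching (petersen_edges n) (spokeless_matching i) ->
  (forall j, spoke j \notin spokeless_matching i) ->
  j < n %/ 4 ->
  letter_at (spokeless_matching i) (shift i (4 * j)) = B0 /\
  has_inner (letter_at (spokeless_matching i) (shift i (4 * j + 1))).
Proof.
move=> n4 pM ns jt.
have inM e : e \in [set [set u (shift i (4 * j)); u (shift i (4 * j + 2))];
         [set u (shift i (4 * j + 1)); u (shift i (4 * j + 3))];
         [set v (shift i (4 * j)); v (shift i (4 * j + 1))];
         [set v (shift i (4 * j + 2)); v (shift i (4 * j + 3))]] ->
    e \in spokeless_matching i.
  by move=> eB; apply/bigcupP; exists (Ordinal jt).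
have [_ -> _] := letter_atE pM (shift i (4 * j + 1)).
rewrite /letter_at (negPf (ns _)) !inM ?inE /inner /outer ?shift_shift -?addnA ?eqxx ?orbT //.
Qed.

Lemma forcing_number_M1 M : M \in M1 n ->
  forcing_number (petersen_edges n) M <= (n + 3) %/ 4.
Proof.
rewrite inE => /andP[pM /orP[/andP[/existsP[i iM] /forallP gaps]|]].
  have wA : forall i, walk stepA (fun k => letter_at M (shift i k)).
    have [//|wB] := letter_walk pM; exfalso.
    have nn : n.-1.+1 = n by lia.
    (* The witness [n.-1] returns to [i] itself, which covers a unique spoke; the minimal [g] is the
       gap after [i]. *)
    have ex : exists g, spoke (shift i g.+1) \in M.
      by exists n.-1; rewrite nn shift_n.
    have [g gM gmin] := ex_minnP ex.
    have gn : g < n by have := gmin n.-1; rewrite nn shift_n iM => /(_ isT); lia.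
    have g4 : 4 %| g.
      have /implyP := forallP (gaps i) (Ordinal gn); apply.
      rewrite /consecutive_spokes iM gM; apply/forallP => k; apply/implyP => kg.
      by apply/negP => /gmin; rewrite leqNgt kg.
    have spE k : is_spoke (letter_at M (shift i k)) = (spoke (shift i k) \in M).
      by have [] := letter_atE pM (shift i k).
    suff: ~~ is_spoke (letter_at M (shift i g.+1)) by rewrite spE gM.
    apply: (classB_gap (wB i) _ g4) => [|k kg]; first by rewrite shift0 /letter_at iM.
    by rewrite spE; apply/negP => /gmin; lia.
  (* Either some spoke is followed by a block, or spokes propagate around the whole cycle. *)
  have [/existsP[j /andP[jM jB]]|none] :=
      boolP [exists j, (spoke j \in M) && has_inner (letter_at M (shift j 1))].
    apply: (@forcing_number_spoke _ j) => //; left.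
    have := wA j 0; rewrite shift0 {1}/letter_at jM.
    by case: (letter_at M (shift j 1)) jB.
  apply: (@forcing_number_spoke _ i) => //; right => j.
  have [k _ ->] := shift_onto i j; elim: k => [|k IH]; first by rewrite shift0 /letter_at iM.
  have := wA i k; rewrite /= IH; case e: (letter_at M (shift i k.+1)) => // _.
  case/existsP: none; exists (shift i k).
  by rewrite shift_shift addn1 e; have [<-] := letter_atE pM (shift i k); rewrite IH.
move=> /and3P[/forallP ns n4 /existsP[i /eqP eM]]; subst M.
have x4 (j : nat) (jt : j < n %/ 4) := spokeless_letters n4 pM ns jt.
rewrite (_ : (n + 3) %/ 4 = n %/ 4); last lia.
apply: (@forcing_number_spokeless _ i) => //; first lia.
  by move=> j jt; have [] := x4 j jt.
have [//|wB] := letter_walk pM; have [|e0 e1] := x4 0 _; first lia.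
by have := wB i 0; rewrite /= -[in X in stepB X _](muln0 4) e0; case: (letter_at _ _) e1.
Qed.

Lemma forcing_number_all_spokes :
  (n + 3) %/ 4 <= forcing_number (petersen_edges n) all_spokes.
Proof.
have [[S fS <-] _] := forcing_numberP set0_not_edge all_spokes_perfect.
have := forcing_set_all_spokes_card fS; lia.
Qed.

Lemma max_forcing_number_M1 :
  \max_(M in M1 n) forcing_number (petersen_edges n) M = (n + 3) %/ 4.
Proof.
apply/eqP; rewrite eqn_leq; apply/andP; split.
  by apply/bigmax_leqP => M; apply: forcing_number_M1.
apply: leq_trans forcing_number_all_spokes _.
by apply: (@leq_bigmax_cond _ _ _ all_spokes); apply: all_spokes_M1.
Qed.

End Petersen.

Import GRing.Theory Num.Theory.
Local Open Scope ring_scope.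

(* \max is 0 on an empty family, so a positive value is an attained maximum. *)
Theorem theorem3p1 (n : nat) (hn : (9 <= n)%N) :
  (\max_(M in M1 n) forcing_number (petersen_edges n) M)%N%:Z
  = Num.ceil (n%:R / 4%:R : rat).
Proof.
rewrite max_forcing_number_M1 //; apply/esym/eqP.
rewrite ceil_eq rmorphB /= -!pmulrn.
have lo : n%:R <= ((n + 3) %/ 4 * 4)%:R :> rat by rewrite ler_nat; lia.
(* The slack 3, less than 4, yields the strict lower bound required of a ceiling. *)
have hi : ((n + 3) %/ 4 * 4)%:R <= (n + 3)%:R :> rat by rewrite ler_nat; lia.
rewrite natrM in lo; rewrite natrM natrD in hi.
by apply/andP; split; lra.
Qed.
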